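(* Let $G$ be a graph and let $k$ be a positive integer. Assume that $G$ is $(3k-3)$-edge-connected or $(2k-2)$-tree-connected. If there is a vertex set $Z\subseteq V(G)$ with $|E(G)|\equiv \sum_{v\in Z} d_G(v) \pmod k$, then $G$ can be edge-decomposed into $k$ factors $G_1,\ldots,G_k$ satisfying $\big||E(G_i)|-|E(G)|/k\big|<1$ for all $i$, such that for each $i$ and each vertex $v$, $$|d_{G_i}(v)-d_G(v)/k|<1.$$ Furthermore, the same conclusion holds if instead $G$ is a loopless $(2k-1)$-edge-connected essentially $(3k-3)$-edge-connected graph (with such a set $Z$).
   Context: Graphs are finite and may have loops and multiple edges; a loop contributes $2$ to the degree $d_G(v)$. A factor is a spanning subgraph; ''edge-decomposed into factors $G_1,\ldots,G_k$'' means $E(G)$ is partitioned into $E(G_1),\ldots,E(G_k)$ with each $G_i$ spanning. A graph is $m$-tree-connected if it contains $m$ edge-disjoint spanning trees. A graph is essentially $\lambda$-edge-connected if all edges of any edge cut of size strictly less than $\lambda$ are incident with a single vertex. *)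

(* Defs.v *)
From HB Require Import structures.
From mathcomp Require Import all_boot all_order all_algebra.

Set Implicit Arguments.
Unset Strict Implicit.
Unset Printing Implicit Defensive.

Import Order.TTheory GRing.Theory Num.Theory.

(* Finite undirected multigraphs, loops allowed.  The two ends of an edge are
   stored in an arbitrary order; no notion below depends on that order. *)
Record multigraph := Multigraph {
  vertex : finType;
  edge : finType;
  ends : edge -> vertex * vertex
}.

Section Multigraph.
Variable G : multigraph.
Implicit Types (F : {set edge G}) (X : {set vertex G}) (v x y : vertex G).

(* A factor, being a spanning subgraph, is given by its edge set.  Counting
   the two ends separately makes a loop contribute 2. *)
Definition factor_degree F v : nat :=
  #|[set e in F | (ends e).1 == v]| + #|[set e in F | (ends e).2 == v]|.

Definition degree v : nat := factor_degree [set: edge G] v.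

Definition incident (e : edge G) v : bool :=
  ((ends e).1 == v) || ((ends e).2 == v).

Definition loopless : Prop := forall e : edge G, (ends e).1 != (ends e).2.

Definition pairwise_edge_disjoint (m : nat) (F : 'I_m -> {set edge G}) : Prop :=
  forall i j : 'I_m, i != j -> [disjoint F i & F j].

(* Factors without edges are allowed, as opposed to [finset.partition]. *)
Definition decomposed_into (k : nat) (F : 'I_k -> {set edge G}) : Prop :=
  pairwise_edge_disjoint F /\ \bigcup_(i < k) F i = [set: edge G].

Definition adjacent F : rel (vertex G) :=
  [rel x y | [exists e in F, (ends e == (x, y)) || (ends e == (y, x))]].

Definition connected F : Prop := forall x y, connect (adjacent F) x y.

(* A dart is an edge with a direction of traversal. *)
Definition dart_tail (d : edge G * bool) : vertex G :=
  if d.2 then (ends d.1).2 else (ends d.1).1.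
Definition dart_head (d : edge G * bool) : vertex G :=
  if d.2 then (ends d.1).1 else (ends d.1).2.

(* Loops are cycles of length 1 and pairs of parallel edges are cycles of
   length 2; [uniq] on edges excludes traversing one edge back and forth. *)
Definition graph_cycle F (p : seq (edge G * bool)) : bool :=
  [&& p != [::],
      all (fun d => d.1 \in F) p,
      cycle (fun d d' => dart_head d == dart_tail d') p,
      uniq [seq dart_tail d | d <- p]
    & uniq [seq d.1 | d <- p]].

Definition acyclic F : Prop := forall p, ~~ graph_cycle F p.

Definition spanning_tree F : Prop := connected F /\ acyclic F.

Definition tree_connected (m : nat) : Prop :=
  exists T : 'I_m -> {set edge G},
    pairwise_edge_disjoint T /\ forall i, spanning_tree (T i).

Definition edge_cut X : {set edge G} :=
  [set e | ((ends e).1 \in X) != ((ends e).2 \in X)].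

(* A one-vertex graph has no cut, hence is l-edge-connected for all l. *)
Definition edge_connected (l : nat) : Prop :=
  forall X, X != set0 -> X != [set: vertex G] -> l <= #|edge_cut X|.

Definition essentially_edge_connected (l : nat) : Prop :=
  forall X, X != set0 -> X != [set: vertex G] -> #|edge_cut X| < l ->
    exists v, forall e, e \in edge_cut X -> incident e v.

Local Open Scope ring_scope.

Definition has_equitable_decomposition (k : nat) : Prop :=
  exists F : 'I_k -> {set edge G},
    [/\ decomposed_into F,
        forall i, `|#|F i|%:R - #|edge G|%:R / k%:R| < 1 :> rat
      & forall i v,
          `|(factor_degree (F i) v)%:R - (degree v)%:R / k%:R| < 1 :> rat].

End Multigraph.

(* Main.v *)
Require Import Defs.
From mathcomp Require Import all_boot all_order all_algebra zify.

(* It suffices that G contains k - 1 edge-disjoint connected spanning subgraphs; by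
   the Nash-Williams-Tutte argument this follows from (2k-2)-edge-connectivity.

   The set Z yields a distribution of every degree into k equitable shares such that
   the shares of each colour have an even sum over the vertices.  Colours 1, ..., k-1
   receive, inside the k - 1 connected subgraphs, edge sets whose degrees have the
   parities of the shares; the remaining edges, of colour k, then have the right
   parities as well.  Now minimise the sum of the squares of the degrees: swapping two
   colours along an alternating trail shows that any two colours differ by at most 2
   at each vertex, and the number of odd degrees at the vertex then forces the
   distribution to be equitable.  Further swaps balance the sizes of the factors. *)

(** Parities are fixed in advance because swaps alone can stall: in an odd cycle with k = 2 some
    vertex has degrees 2 and 0 under every colouring. A difference of exactly 2 is therefore
    excluded by counting the odd degrees at the vertex, a number that the swaps preserve. One
    connected subgraph per prescribed colour is enough, because a connected graph contains, for
    every vertex set T of even size, an edge set whose odd-degree vertices are exactly those of T;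
    the even sums of the shares provide the even size. Trails are orbits of two involutions on
    darts, reversal and a pairing at each vertex, which treats loops and repeated vertices
    uniformly. *)

Set Implicit Arguments.
Unset Strict Implicit.
Unset Printing Implicit Defensive.

(** * Matchings and pairs of involutions *)


Section Involutions.
Variable T : finType.

(** A matching is encoded as an involution whose fixed points are the unmatched elements. One that
    moves the most points is maximal, since two related fixed points could be interchanged in
    addition. *)
Lemma maximal_matching (r : rel T) :
  symmetric r -> irreflexive r ->
  exists p : T -> T, [/\ involutive p, forall x, p x != x -> r x (p x)
    & forall x y, p x = x -> p y = y -> ~~ r x y].
Proof.
move=> rC rI.
pose P (f : {ffun T -> T}) :=
  [forall x, (f (f x) == x) && ((f x != x) ==> r x (f x))].
have P0 : P (finfun id) by apply/forallP=> x; rewrite !ffunE !eqxx.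
case: (@arg_maxnP _ _ P (fun f : {ffun T -> T} => #|[set x | f x != x]|) P0)
  => f /forallP Pf fmax.
have fK : involutive f by move=> x; case/andP: (Pf x) => /eqP.
exists f; split=> // [x fx|x y fx fy].
  by case/andP: (Pf x) => _ /implyP /(_ fx).
apply/negP=> rxy.
have nxy : x != y by apply: contraTneq rxy => ->; rewrite rI.
pose g := [ffun z => if z == x then y else if z == y then x else f z].
have Pg : P g.
  apply/forallP=> z; rewrite !ffunE.
  have [->|zx] := eqVneq z x.
    by rewrite !eqxx [y == x]eq_sym (negPf nxy) /= !eqxx rxy.
  have [->|zy] := eqVneq z y; first by rewrite !eqxx /= rC rxy implybT.
  have [fzx|_] := eqVneq (f z) x.
    by rewrite -(fK z) fzx fx eqxx in zx.
  have [fzy|_] := eqVneq (f z) y.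
    by rewrite -(fK z) fzy fy eqxx in zy.
  exact: (Pf z).
have := fmax g Pg; apply/negP; rewrite -ltnNge; apply: proper_card.
apply/properP; split; last first.
  by exists x; rewrite !inE ?ffunE ?eqxx ?fx ?eqxx // eq_sym.
apply/subsetP=> z; rewrite !inE ffunE.
have [->|_] := eqVneq z x; first by rewrite fx eqxx.
by have [->|_] := eqVneq z y; first by rewrite fy eqxx.
Qed.

Lemma card_fixfree_involution (p : T -> T) (A : {set T}) :
  involutive p -> {in A, forall x, p x \in A} -> {in A, forall x, p x != x} ->
  ~~ odd #|A|.
Proof.
move=> pK; have [n] := ubnP #|A|; elim: n A => // n IH A ltAn pA pN.
have [->|[x xA]] := set_0Vmem A; first by rewrite cards0.
have pxA : p x \in A :\ x by rewrite !inE pN ?pA.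
have := cardsD1 x A; rewrite xA (cardsD1 (p x) (A :\ x)) pxA => cA.
rewrite cA /= negbK; apply: IH; first by lia.
  move=> y; rewrite !inE => /and3P[ypx yx yA]; rewrite pA // andbT.
  rewrite (inj_eq (can_inj pK)) yx /=.
  by apply: contraNneq ypx => <-; rewrite pK.
by move=> y; rewrite !inE => /and3P[_ _ yA]; apply: pN.
Qed.

(* The orbit of [a] under [p \o s] is a cycle on which [s] and [p] act as
   reflections, so [p] fixes exactly one further point, opposite to [a]. *)
Lemma involution_orbits (s p : T -> T) :
  involutive s -> involutive p -> (forall x, s x != x) ->
  exists (K : T -> {set T}) (q : T -> T), forall a, p a = a ->
    [/\ [/\ a \in K a, q a \in K a, q a != a, p (q a) = q a & q (q a) = a],
        {in K a, forall x, s x \in K a}, {in K a, forall x, p x \in K a},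
        {in K a, forall x, p x = x -> x = a \/ x = q a}
      & forall S : {set T}, a \in S -> {in S, forall x, s x \in S} ->
          {in S, forall x, p x \in S} -> K a \subset S].
Proof.
move=> sK pK sN; pose f x := p (s x).
have f_inj : injective f by move=> x y /(inv_inj pK) /(inv_inj sK).
exists (fun a => [set x | fconnect f a x]), (fun a => iter (order f a)./2 f a).
move=> a pa; set n := order f a.
have n_gt0 : 0 < n by apply: order_gt0.
have nK : iter n f a = a by apply: iter_order.
have sf i : iter i.+1 f (s (iter i f a)) = a.
  elim: i => [|i IH]; first by rewrite /= /f sK.
  by rewrite iterSr /f sK -/f [iter i.+1 f a]/= {2}/f pK.
have pf i : p (iter i.+1 f a) = s (iter i f a) by rewrite /= /f pK.
have fcC := fconnect_sym f_inj.
have sA x : fconnect f a x -> fconnect f a (s x).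
  move=> /iter_findex <-; set i := findex f a x.
  by rewrite fcC -{2}(sf i); apply: fconnect_iter.
have pA x : fconnect f a x -> fconnect f a (p x).
  move=> /iter_findex <-; case: (findex f a x) => [|i]; first by rewrite /= pa.
  by rewrite pf; apply: sA; apply: fconnect_iter.
have iter_inj i : injective (iter i f).
  by elim: i => // i IH x y /= /f_inj /IH.
(* In an orbit of odd length the reflection [s] would fix the point halfway round. *)
have n_even : n = (n./2).*2.
  have := odd_double_half n; case: (boolP (odd n)) => //= _ defn.
  case/negP: (sN (iter n./2 f a)); apply/eqP; apply: (@iter_inj (n./2).+1).
  rewrite sf -iterD; have -> : ((n./2).+1 + n./2 = n)%N by lia.
  by rewrite nK.
have hN0 : 0 < n./2 by lia.
have hLn : n./2 < n by lia.
have ord_per m : iter m f a = a -> m %% n = 0.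
  move=> ma; have mn : iter (m %% n) f a = a.
    rewrite -[RHS]ma [in RHS](divn_eq m n) addnC iterD; congr iter.
    by elim: (m %/ n) => // j IH; rewrite mulSn iterD -IH nK.
  by have := findex_iter (ltn_pmod m n_gt0); rewrite mn findex0.
have qq : iter n./2 f (iter n./2 f a) = a.
  by rewrite -iterD addnn -n_even.
split=> [||x||S aS Ss Sp].
- split; rewrite ?inE ?connect0 ?fconnect_iter //.
  + apply/eqP=> /(congr1 (findex f a)); rewrite findex_iter // findex0.
    by lia.
  + case: (n./2) hN0 qq (sf (n./2).-1) => // j _ qq sfj.
    by rewrite pf; apply: (@iter_inj j.+1); rewrite qq.
  + suff -> : order f (iter n./2 f a) = n by [].
    by rewrite /n /order; apply: eq_card => y; rewrite !inE;
      rewrite (same_connect fcC (fconnect_iter f n./2 a)).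
- by move=> x; rewrite !inE; apply: sA.
- by rewrite !inE; apply: pA.
- move=> x; rewrite inE => ax; have := findex_max ax; rewrite -/n.
  rewrite -{2 3 4 5}(iter_findex ax); case: (findex f a x) => [|i] ltin px.
    by left.
  right; rewrite pf in px; have := sf i; rewrite px -iterD => /ord_per.
  move=> per; have -> // : i.+1 = n./2.
  have : n %| i.+1 + i.+1 by apply/eqP.
  case/dvdnP => m; case: m => [|[|m]]; lia.
- apply/subsetP=> x; rewrite inE => /iter_findex <-.
  by elim: (findex f a x) => //= m IH; apply/Sp/Ss.
Qed.

End Involutions.

(** * Darts and recolouring *)


Section Darts.
Variable G : multigraph.
Implicit Types (F : {set edge G}) (v w : vertex G) (d : edge G * bool).

Definition dart_rev d : edge G * bool := (d.1, ~~ d.2).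

Lemma dart_revK : involutive dart_rev.
Proof. by case=> e b; rewrite /dart_rev /= negbK. Qed.

Lemma dart_rev_neq d : dart_rev d != d.
Proof. by case: d => e []; rewrite /dart_rev xpair_eqE eqxx. Qed.

Lemma card_darts (A B : pred (edge G)) :
  #|[set d : edge G * bool | if d.2 then A d.1 else B d.1]|
  = #|[set e | B e]| + #|[set e | A e]|.
Proof.
set D := [set d | _].
have inj (b : bool) : injective (fun e : edge G => (e, b)) by move=> x y [].
rewrite -(card_imset _ (inj false)) -(card_imset _ (inj true)).
rewrite -cardsUI [X in _ + X](_ : _ = 0) ?addn0.
  apply: eq_card => -[e b]; rewrite !inE /=; case: b.
  - rewrite [X in X || _](_ : _ = false) /=; last by apply/imsetP=> -[].
    by rewrite mem_imset // inE.
  - rewrite [X in _ || X](_ : _ = false) ?orbF; last by apply/imsetP=> -[].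
    by rewrite mem_imset // inE.
by apply/eqP; rewrite cards_eq0; apply/eqP/setP => x; rewrite !inE;
  apply/andP=> -[/imsetP[e _ ->] /imsetP[]].
Qed.

Lemma factor_degreeE F v : factor_degree F v =
  #|[set d : edge G * bool | (d.1 \in F) && (dart_tail d == v)]|.
Proof.
rewrite /factor_degree -(card_darts (fun e => (e \in F) && ((ends e).2 == v))
  (fun e => (e \in F) && ((ends e).1 == v))).
by apply: eq_card => -[e []]; rewrite !inE.
Qed.

Lemma card_factorE F :
  #|F|.*2 = #|[set d : edge G * bool | d.1 \in F]|.
Proof.
have := card_darts (mem F) (mem F).
rewrite [[set e | _]](_ : _ = F) ?addnn => [<-|]; last by apply/setP=> e; rewrite inE.
by apply: eq_card => -[e []]; rewrite !inE.
Qed.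

Lemma sum_factor_degree F : \sum_v factor_degree F v = #|F|.*2.
Proof.
rewrite card_factorE -sum1_card (partition_big (@dart_tail G) xpredT) //=.
apply: eq_bigr => v _; rewrite factor_degreeE -sum1_card.
by apply: eq_bigl => d; rewrite !inE.
Qed.

End Darts.

Section Recolouring.
Variables (G : multigraph) (C : finType) (c : edge G -> C) (i j : C).
Hypothesis nij : i != j.
Implicit Types (d : edge G * bool) (K : {set edge G * bool}).

Definition colour_class (c' : edge G -> C) (a : C) : {set edge G} :=
  [set e | c' e == a].

Definition two_coloured d := (c d.1 == i) || (c d.1 == j).

(** Testing one dart suffices for a set closed under [dart_rev], which contains both darts of an
    edge or neither. *)
Definition recolour K (e : edge G) : C :=
  if (e, false) \in K then
    if c e == i then j else if c e == j then i else c e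
  else c e.

Variable p : edge G * bool -> edge G * bool.
Hypotheses (pK : involutive p)
  (p_two : forall d, two_coloured d -> two_coloured (p d)).

Definition dart_count (c' : edge G -> C) (P : pred (edge G * bool)) (a : C) :=
  #|[set d | (c' d.1 == a) && P d]|.

(** The partner may be [d] itself or another dart of the same colour; in both cases [d] is not
    balanced by a dart of the other colour. *)
Definition unmatched (P : pred (edge G * bool)) (a : C) :=
  [set d | [&& c d.1 == a, P d & c (p d).1 == a]].

Section Count.
Variables (P : pred (edge G * bool)) (K : {set edge G * bool}).
Hypotheses (pP : forall d, P (p d) = P d) (Kp : {in K, forall d, p d \in K}).

Let count (a : C) := #|[set d in K | (c d.1 == a) && P d]|.
Let matched (a : C) := [set d in K | [&& c d.1 == a, P d & c (p d).1 != a]].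

Let countE a : count a = #|K :&: unmatched P a| + #|matched a|.
Proof.
rewrite /count -(cardsID [set d | c (p d).1 == a]); congr (_ + _);
  apply: eq_card => d; rewrite !inE.
  by case: (d \in K); case: (P d); case: (c d.1 == a); case: (c _ == a).
by case: (d \in K); case: (P d); case: (c d.1 == a); case: (c _ == a).
Qed.

Let matched_le a b : (a = i /\ b = j) \/ (a = j /\ b = i) ->
  #|matched a| <= #|matched b|.
Proof.
move=> ab; rewrite -(card_imset _ (inv_inj pK)); apply: subset_leq_card.
apply/subsetP=> _ /imsetP[d + ->]; rewrite !inE pP pK.
case/and4P=> dK /eqP cd Pd pd; rewrite Kp // Pd cd.
have := @p_two d; rewrite /two_coloured cd.
case: ab pd => -[-> ->] /negPf->; rewrite !eqxx ?orbT => /(_ isT) /=.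
  by move=> ->; rewrite nij.
by rewrite orbF => ->; rewrite eq_sym nij.
Qed.

(** The darts whose partner has the other colour are paired off by [p], one of colour [i] with one
    of colour [j], so they cancel. *)
Lemma count_unmatched :
  count i + #|K :&: unmatched P j| = count j + #|K :&: unmatched P i|.
Proof.
rewrite !countE; have : #|matched i| = #|matched j|.
  by apply/eqP; rewrite eqn_leq !matched_le //; [right|left].
by move=> ->; lia.
Qed.

Hypotheses (Krev : {in K, forall d, dart_rev d \in K})
  (K_two : {in K, forall d, two_coloured d}).

Lemma recolourE d : recolour K d.1 =
  if d \in K then if c d.1 == i then j else i else c d.1.
Proof.
have dK : ((d.1, false) \in K) = (d \in K).
  case: d => e [] //=; apply/idP/idP => h; first by have := Krev h.
  by have := Krev h.
rewrite /recolour dK; case: ifP => // h; case: eqP => // ci.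
by have := K_two h; rewrite /two_coloured; case: (c d.1 =P i) => //= _ ->.
Qed.

Let dart_count_split c' a : dart_count c' P a =
  #|[set d in K | (c' d.1 == a) && P d]| +
  #|[set d in ~: K | (c' d.1 == a) && P d]|.
Proof.
rewrite /dart_count -(cardsID K [set d | (c' d.1 == a) && P d]).
by congr (_ + _); apply: eq_card => d; rewrite !inE andbC.
Qed.

Let outside a : #|[set d in ~: K | (recolour K d.1 == a) && P d]| =
  #|[set d in ~: K | (c d.1 == a) && P d]|.
Proof.
apply: eq_card => d; rewrite !inE recolourE.
by case: (d \in K).
Qed.

Let inside_i : #|[set d in K | (recolour K d.1 == i) && P d]| = count j.
Proof.
apply: eq_card => d; rewrite !inE recolourE; case: (boolP (d \in K)) => //= dK.
have := K_two dK; rewrite /two_coloured; case: (c d.1 =P i) => [->|_ /= ->].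
  by rewrite [j == i]eq_sym.
by rewrite eqxx.
Qed.

Let inside_j : #|[set d in K | (recolour K d.1 == j) && P d]| = count i.
Proof.
apply: eq_card => d; rewrite !inE recolourE; case: (boolP (d \in K)) => //= dK.
by case: ifP => _; rewrite ?eqxx // (negPf nij).
Qed.

(** Inside [K] the two counts are interchanged, and by [count_unmatched] they differ only by
    unmatched darts. Writing the terms on both sides avoids truncated subtraction. *)
Lemma recolour_i :
  dart_count (recolour K) P i + #|K :&: unmatched P i|
  = dart_count c P i + #|K :&: unmatched P j|.
Proof.
rewrite !dart_count_split inside_i outside -/(count i).
by have := count_unmatched; lia.
Qed.

Lemma recolour_j :
  dart_count (recolour K) P j + #|K :&: unmatched P j|
  = dart_count c P j + #|K :&: unmatched P i|.
Proof.
rewrite !dart_count_split inside_j outside -/(count j).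
by have := count_unmatched; lia.
Qed.

Lemma recolour_other a : a != i -> a != j ->
  dart_count (recolour K) P a = dart_count c P a.
Proof.
move=> ai aj; rewrite !dart_count_split outside; congr (_ + _).
apply: eq_card => d; rewrite !inE recolourE; case: (boolP (d \in K)) => //= dK.
have := K_two dK; rewrite /two_coloured.
case: (c d.1 =P i) => [->|_ /= /eqP->].
  by rewrite ![_ == a]eq_sym (negPf ai) (negPf aj).
by rewrite ![_ == a]eq_sym (negPf ai) (negPf aj).
Qed.

End Count.

Lemma dart_count_unmatched (P : pred (edge G * bool)) :
  (forall d, P (p d) = P d) ->
  dart_count c P i + #|unmatched P j| = dart_count c P j + #|unmatched P i|.
Proof.
move=> pP; have := @count_unmatched P setT pP.
rewrite !setTI => /(_ (fun d _ => in_setT _)).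
by congr (_ + _ = _ + _); apply: eq_card => d; rewrite !inE.
Qed.

End Recolouring.

Lemma factor_degree_count (G : multigraph) (C : finType) (c : edge G -> C) a v :
  factor_degree (colour_class c a) v =
  dart_count c (fun d => dart_tail d == v) a.
Proof. by rewrite factor_degreeE; apply: eq_card => d; rewrite !inE. Qed.

Lemma card_class_count (G : multigraph) (C : finType) (c : edge G -> C) a :
  #|colour_class c a|.*2 = dart_count c xpredT a.
Proof. by rewrite card_factorE; apply: eq_card => d; rewrite !inE andbT. Qed.

(** * Alternating trails *)


Section Exchange.
Variables (G : multigraph) (C : finType) (c : edge G -> C) (i j : C).
Hypothesis nij : i != j.
Implicit Types (d : edge G * bool) (w : vertex G).
Local Notation cdeg c a w := (factor_degree (colour_class c a) w).
Local Notation two := (two_coloured c i j).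
Local Notation at_vertex w := (fun d => dart_tail d == w).

(** The last clause is maximality: the two-coloured darts left over at a vertex all have the colour
    that is in excess there. *)
Lemma alternating_matching : exists p : edge G * bool -> edge G * bool,
  [/\ involutive p, forall d, dart_tail (p d) = dart_tail d,
      forall d, two d -> two (p d), forall d, p d != d -> c (p d).1 != c d.1
    & forall d d', p d = d -> p d' = d' -> two d -> two d' ->
        dart_tail d = dart_tail d' -> c d.1 = c d'.1].
Proof.
pose r d d' := [&& two d, two d', dart_tail d == dart_tail d' & c d.1 != c d'.1].
have rC : symmetric r.
  move=> d d'; rewrite /r [dart_tail d == _]eq_sym [c d.1 == _]eq_sym.
  by case: (two d); case: (two d').
have rI : irreflexive r by move=> d; rewrite /r !eqxx !andbF.
have [p [pK pr pmax]] := maximal_matching rC rI.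
exists p; split=> //.
- by move=> d; have [->//|/pr/and4P[_ _ /eqP]] := eqVneq (p d) d.
- by move=> d td; have [->//|/pr/and4P[]] := eqVneq (p d) d.
- by move=> d /pr/and4P[_ _ _]; rewrite eq_sym.
- move=> d d' pd pd' td td' tdd'; have := pmax d d' pd pd'.
  by rewrite /r td td' tdd' eqxx /= negbK => /eqP.
Qed.

Lemma card_two_coloured w :
  cdeg c i w + cdeg c j w = #|[set d | two d && (dart_tail d == w)]|.
Proof.
rewrite !factor_degree_count -cardsUI [X in _ + X](_ : _ = 0) ?addn0.
  by apply: eq_card => d; rewrite !inE -andb_orl.
apply/eqP; rewrite cards_eq0; apply/eqP/setP=> d; rewrite !inE.
by case: eqP => //= ->; rewrite (negPf nij) !andbF.
Qed.

(* The i- and j-edges are cut into trails by pairing the darts at each vertex: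
   first an i-dart with a j-dart, as long as possible, and then, at each even
   vertex other than [v], the remaining darts with each other.  Swapping the two
   colours along a trail with an end at [v] moves the two degrees towards each
   other at [v], and nowhere away from each other. *)
Lemma exchange_degree v : cdeg c j v + 2 < cdeg c i v ->
  exists c' : edge G -> C,
  [/\ forall a w, a != i -> a != j -> cdeg c' a w = cdeg c a w,
      forall w, cdeg c' i w + cdeg c' j w = cdeg c i w + cdeg c j w,
      forall w, cdeg c i w * cdeg c j w <= cdeg c' i w * cdeg c' j w,
      cdeg c i v * cdeg c j v < cdeg c' i v * cdeg c' j v
    & forall w, ~~ odd (cdeg c i w + cdeg c j w) ->
        odd (cdeg c' i w) = odd (cdeg c i w)].
Proof.
move=> vgt; have [p1 [p1K p1T p1two p1alt p1max]] := alternating_matching.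
(* At the vertices in [Y] no trail may end, so that the parities survive the swap; [v] is left out
   since trails are to end there. *)
pose Y w := ~~ odd (cdeg c i w + cdeg c j w) && (w != v).
pose r d d' := [&& d != d', (p1 d == d) && (p1 d' == d'), two d && two d',
  dart_tail d == dart_tail d' & Y (dart_tail d)].
have rC : symmetric r.
  move=> d d'; rewrite /r [d == _]eq_sym [dart_tail d == _]eq_sym.
  rewrite [(p1 d == d) && _]andbC [two d && _]andbC.
  by case: (dart_tail d' =P dart_tail d) => [->|]; rewrite ?andbF.
have rI : irreflexive r by move=> d; rewrite /r eqxx.
have [p2 [p2K p2r p2max]] := maximal_matching rC rI.
pose p d := if p1 d == d then p2 d else p1 d.
have pK : involutive p.
  move=> d; rewrite /p; case: (p1 d =P d) => [p1d|p1d]; last first.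
    by rewrite p1K eq_sym; case: eqP.
  have [p2d|/p2r/and5P[_ /andP[_ ->] _ _ _]] := eqVneq (p2 d) d.
    by rewrite p2d p1d eqxx p2d.
  by rewrite p2K.
have pT d : dart_tail (p d) = dart_tail d.
  rewrite /p; case: eqP => // _.
  by have [->//|/p2r/and5P[_ _ _ /eqP]] := eqVneq (p2 d) d.
have ptwo d : two d -> two (p d).
  rewrite /p; case: eqP => [_ td|_]; last exact: p1two.
  by have [->//|/p2r/and5P[_ _ /andP[]]] := eqVneq (p2 d) d.
have punm d : c (p d).1 = c d.1 -> p1 d = d.
  by rewrite /p; case: eqP => // /eqP /p1alt /negP h /eqP.
have pfix d : p d = d -> p1 d = d /\ p2 d = d.
  by rewrite /p; case: eqP => // + <-.
have pP w d : at_vertex w (p d) = at_vertex w d by rewrite /= pT.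
pose U w a := unmatched c p (at_vertex w) a.
have twoi d : c d.1 == i -> two d by rewrite /two_coloured => ->.
have twoj d : c d.1 == j -> two d by rewrite /two_coloured orbC => ->.
have mono w : #|U w i| = 0 \/ #|U w j| = 0.
  have [->|[d dU]] := set_0Vmem (U w i); first by rewrite cards0; left.
  have [->|[d' d'U]] := set_0Vmem (U w j); first by rewrite cards0; right.
  move: dU d'U; rewrite !inE => /and3P[ci /eqP dw cpi] /and3P[cj /eqP d'w cpj].
  case/negP: nij; rewrite -(eqP ci) -(eqP cj); apply/eqP.
  apply: p1max.
  - by apply: punm; rewrite (eqP ci) (eqP cpi).
  - by apply: punm; rewrite (eqP cj) (eqP cpj).
  - exact: twoi.
  - exact: twoj.
  - by rewrite dw d'w.
have degU w : cdeg c i w + #|U w j| = cdeg c j w + #|U w i|.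
  by rewrite !factor_degree_count; apply: dart_count_unmatched.
(* By maximality of [p2] at most one two-coloured dart at such a vertex is fixed; as their number is
   even, none is. *)
have nofix d : two d -> Y (dart_tail d) -> p d != d.
  move=> td Yd; apply/eqP=> pd; set w := dart_tail d in Yd.
  pose S := [set d | two d && (dart_tail d == w)].
  have /negP[] : ~~ odd #|S :\ d|.
    apply: (card_fixfree_involution pK) => d'; rewrite !inE => /and3P[d'd td' d'w].
      rewrite ptwo // pT d'w !andbT; apply: contra_neq d'd => pd'.
      by rewrite -[d']pK pd' pd.
    apply/eqP=> pd'; have := p2max d d' (pfix _ pd).2 (pfix _ pd').2.
    rewrite /r eq_sym d'd (pfix _ pd).1 (pfix _ pd').1 !eqxx td td' /=.
    by rewrite eq_sym d'w Yd.
  have dS : d \in S by rewrite inE td /=.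
  case/andP: Yd; rewrite card_two_coloured -/S (cardsD1 d S) dS add1n /=.
  by rewrite negbK.
have [K [q Kq]] := involution_orbits (@dart_revK G) pK (@dart_rev_neq G).
have UvP d : d \in U v i -> [/\ p d = d, two d & dart_tail d = v].
  rewrite inE => /and3P[ci /eqP dv cpi]; split=> //; last exact: twoi.
  have p1d : p1 d = d by apply: punm; rewrite (eqP ci) (eqP cpi).
  rewrite /p p1d eqxx; have [//|/p2r/and5P[_ _ _ _]] := eqVneq (p2 d) d.
  by rewrite /Y dv eqxx andbF.
pose closed (L : {set edge G * bool}) := [/\ {in L, forall d, p d \in L},
  {in L, forall d, dart_rev d \in L} & {in L, forall d, two d}].
have Kcl a : a \in U v i -> closed (K a).
  move=> aU; have [pa ta _] := UvP a aU.
  have [_ Kr Kp _ Ksub] := Kq a pa.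
  have /subsetP sub : K a \subset [set d | two d].
    by apply: Ksub => [|d|d]; rewrite !inE //; apply: ptwo.
  by split=> // d /sub; rewrite inE.
have KU a : a \in U v i ->
    K a :&: U v i = if q a \in U v i then [set a; q a] else [set a].
  move=> aU; have [pa ta _] := UvP a aU.
  have [[aK qK qa _ _] _ _ Kfix _] := Kq a pa.
  have sub d : d \in K a :&: U v i -> d = a \/ d = q a.
    by case/setIP=> dK /UvP[pd _ _]; apply: Kfix.
  apply/setP=> d; apply/idP/idP => [dKU|].
    case/setIP: (dKU) => _ dU.
    case: (sub d dKU) dU => -> dU; last by rewrite dU !inE eqxx orbT.
    by case: ifP; rewrite !inE eqxx.
  by case: ifP => qU; rewrite ?in_set2 ?in_set1 => h;
    [case/orP: h => /eqP-> | move/eqP: h => ->]; rewrite inE ?aK ?qK ?aU.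
(* The excess of [i] at [v] is the number of trail ends there, at least 3. A trail with both ends
   among them can be swapped by itself. Otherwise one trail is swapped if the excess is odd, and two
   if it is even, to keep the parities at [v]. *)
have [L [Lcl Lgt0 Llt Lodd]] : exists L, [/\ closed L, 0 < #|L :&: U v i|,
    #|L :&: U v i| < #|U v i| & ~~ odd #|U v i| -> ~~ odd #|L :&: U v i|].
  have gt2 : 2 < #|U v i| by have := degU v; lia.
  have [a aU] : exists a, a \in U v i by apply/card_gt0P; lia.
  have [pa _ _] := UvP a aU.
  have [[_ _ qa _ _] _ _ _ _] := Kq a pa.
  case: (boolP (q a \in U v i)) => qU.
    exists (K a); split; [exact: Kcl | | |];
      by rewrite KU // qU cards2 eq_sym qa.
  case: (boolP (odd #|U v i|)) => Dodd.
    exists (K a); split; [exact: Kcl | | |];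
      by rewrite KU // (negPf qU) cards1 // ; lia.
  have [a2 a2U] : exists b, b \in U v i :\ a.
    by apply/card_gt0P; have := cardsD1 a (U v i); rewrite aU; lia.
  have {a2U}[a2a a2U] : a2 != a /\ a2 \in U v i by apply/andP; rewrite -in_setD1.
  have [pa2 _ _] := UvP a2 a2U.
  have [[_ _ qa2 _ _] _ _ _ _] := Kq a2 pa2.
  case: (boolP (q a2 \in U v i)) => q2U.
    exists (K a2); split; [exact: Kcl | | |];
      by rewrite KU // q2U cards2 eq_sym qa2.
  exists (K a :|: K a2).
  have -> : (K a :|: K a2) :&: U v i = [set a; a2].
    by rewrite setIUl !KU // (negPf qU) (negPf q2U).
  rewrite cards2 eq_sym a2a; split=> //.
  have [Kp Kr Kt] := Kcl a aU; have [K2p K2r K2t] := Kcl a2 a2U.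
  split=> d /setUP[] h; rewrite ?in_setU.
  - by rewrite Kp.
  - by rewrite K2p ?orbT.
  - by rewrite Kr.
  - by rewrite K2r ?orbT.
  - exact: Kt.
  - exact: K2t.
case: Lcl => Lp Lr Lt.
exists (recolour c i j L).
have oth a w : a != i -> a != j -> cdeg (recolour c i j L) a w = cdeg c a w.
  by move=> ai aj; rewrite !factor_degree_count recolour_other.
have reci w : cdeg (recolour c i j L) i w + #|L :&: U w i| =
    cdeg c i w + #|L :&: U w j|.
  by rewrite !factor_degree_count; apply: recolour_i.
have recj w : cdeg (recolour c i j L) j w + #|L :&: U w j| =
    cdeg c j w + #|L :&: U w i|.
  by rewrite !factor_degree_count; apply: recolour_j.
have leU w a : #|L :&: U w a| <= #|U w a| by apply/subset_leq_card/subsetIr.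
have leLw := fun w => (leU w i, leU w j, degU w, reci w, recj w, mono w).
split=> //.
- by move=> w; have := reci w; have := recj w; lia.
(* If the excess at [w] is D and u of the excess darts lie in [L], the product grows by u * (D - u).
   At [v], where 0 < u < D, this is positive. *)
- move=> w; have := leLw w.
  move: (cdeg _ _ w) (cdeg _ _ w) (cdeg _ _ w) (cdeg _ _ w) => x y x' y'.
  move: #|_| #|_| #|_| #|_| => u1 u2 u3 u4 [[[[[h1 h2] h3] h4] h5] [h6|h6]]; nia.
- have := leLw v; move: Lgt0 Llt.
  move: (cdeg _ _ v) (cdeg _ _ v) (cdeg _ _ v) (cdeg _ _ v) => x y x' y'.
  move: #|_| #|_| #|_| #|_| => u1 u2 u3 u4 h7 h8 [[[[[h1 h2] h3] h4] h5] [h6|h6]]; nia.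
move=> w ev.
suff [ei ej] : ~~ odd #|L :&: U w i| /\ ~~ odd #|L :&: U w j|.
  by have := reci w; lia.
have [wv|wv] := eqVneq w v.
  rewrite wv in ev *; have [[[[[h1 h2] h3] h4] h5] h6] := leLw v.
  by move: Lgt0 Llt Lodd; lia.
have Yw : Y w by rewrite /Y ev.
have fixfree a : (a == i) || (a == j) -> ~~ odd #|L :&: U w a|.
  move=> aij; apply: (card_fixfree_involution pK) => d;
    rewrite !inE => /andP[dL /and3P[ca /eqP dw cpa]].
    by rewrite Lp // pT dw cpa pK ca eqxx.
  by apply: nofix; rewrite ?dw ///two_coloured (eqP ca).
by split; apply: fixfree; rewrite eqxx ?orbT.
Qed.

(** The larger class [i] has more trail ends than [j], so some alternating trail has both ends of
    colour [i], hence one more [i]-edge than [j]-edges. As the two degrees differ by at most 1, at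
    most one dart per vertex is unmatched, and swapping the trail keeps or interchanges the
    degrees. *)
Lemma exchange_size :
  (forall w, cdeg c i w <= (cdeg c j w).+1 /\ cdeg c j w <= (cdeg c i w).+1) ->
  #|colour_class c j|.+1 < #|colour_class c i| ->
  exists c' : edge G -> C,
  [/\ forall a, a != i -> a != j -> colour_class c' a = colour_class c a,
      forall w, cdeg c' i w = cdeg c i w /\ cdeg c' j w = cdeg c j w \/
        cdeg c' i w = cdeg c j w /\ cdeg c' j w = cdeg c i w,
      #|colour_class c i| = #|colour_class c' i|.+1
    & #|colour_class c' j| = #|colour_class c j|.+1].
Proof.
move=> near big; have [p [pK pT ptwo palt pmax]] := alternating_matching.
have [K [q Kq]] := involution_orbits (@dart_revK G) pK (@dart_rev_neq G).
pose U a := unmatched c p xpredT a.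
have UP a d : d \in U a -> p d = d /\ c d.1 = a.
  rewrite inE => /and3P[/eqP ca _ /eqP cpa]; split=> //.
  by apply: contra_eq cpa => /palt; rewrite ca.
have twoU d : (d \in U i) || (d \in U j) -> two d.
  by case/orP=> /UP[_]; rewrite /two_coloured => ->; rewrite eqxx ?orbT.
have fixU d : p d = d -> two d -> (d \in U i) || (d \in U j).
  by move=> pd; rewrite !inE pd !andbb.
have degU := @dart_count_unmatched _ _ c i j nij p pK ptwo xpredT (fun _ => erefl).
rewrite -/(U i) -/(U j) -!card_class_count in degU.
have Kcl a : a \in U i -> [/\ {in K a, forall d, p d \in K a},
    {in K a, forall d, dart_rev d \in K a} & {in K a, forall d, two d}].
  move=> aU; have [pa _] := UP _ _ aU; have [_ Kr Kp _ Ksub] := Kq a pa.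
  have /subsetP sub : K a \subset [set d | two d].
    apply: Ksub => [|d|d]; rewrite !inE //; last exact: ptwo.
    by rewrite twoU // aU.
  by split=> // d /sub; rewrite inE.
have [a [aU qU]] : exists a, a \in U i /\ q a \in U i.
  suff /existsP[a /andP[]] : [exists a, (a \in U i) && (q a \in U i)] by exists a.
  apply: contraT => /existsPn noq; suff : #|U i| <= #|U j| by lia.
  have q_inj : {in U i &, injective q}.
    move=> a b aU bU qab; have [pa _] := UP _ _ aU; have [pb _] := UP _ _ bU.
    have [[_ _ _ _ qqa] _ _ _ _] := Kq a pa.
    have [[_ _ _ _ qqb] _ _ _ _] := Kq b pb.
    by rewrite -qqa qab.
  rewrite -(card_in_imset q_inj); apply/subset_leq_card/subsetP.
  move=> _ /imsetP[a aU ->]; have [pa _] := UP _ _ aU.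
  have [[_ qK _ pq _] _ _ _ _] := Kq a pa; have [_ _ Kt] := Kcl a aU.
  have := fixU _ pq (Kt _ qK); have := noq a.
  by rewrite aU /= => /negPf->.
have [pa _] := UP _ _ aU; have [Kp Kr Kt] := Kcl a aU.
have [[aK qK qa _ _] _ _ Kfix _] := Kq a pa.
have KUi : K a :&: U i = [set a; q a].
  apply/setP=> d; rewrite in_setI in_set2; apply/andP/orP.
    by case=> dK /UP[pd _]; case: (Kfix d dK pd) => ->; rewrite eqxx; auto.
  by case=> /eqP->; rewrite ?aK ?qK.
have KUj : K a :&: U j = set0.
  apply/setP=> d; rewrite in_setI in_set0; apply/negP=> /andP[dK dU].
  have [pd cd] := UP _ _ dU; case/negP: nij; rewrite -cd eq_sym; apply/eqP.
  by case: (Kfix d dK pd) => ->; [case: (UP _ _ aU) | case: (UP _ _ qU)].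
exists (recolour c i j (K a)).
have reci := @recolour_i _ _ c i j nij p pK ptwo xpredT (K a) (fun _ => erefl) Kp Kr Kt.
have recj := @recolour_j _ _ c i j nij p pK ptwo xpredT (K a) (fun _ => erefl) Kp Kr Kt.
rewrite -/(U i) -/(U j) KUi KUj cards0 cards2 eq_sym qa -!card_class_count in reci recj.
split; [ | |lia|lia].
- move=> b bi bj; apply/setP=> e; rewrite !inE -[e]/(e, false).1 recolourE //.
  case: ifP => // /Kt; rewrite /two_coloured.
  by case: (c e =P i) => [->|_ /= /eqP->]; rewrite ![_ == b]eq_sym (negPf bi) (negPf bj).
- move=> w; have [ij ji] := near w.
  have pP d : dart_tail (p d) == w = (dart_tail d == w) by rewrite pT.
  pose Uw b := unmatched c p (at_vertex w) b.
  have degw := dart_count_unmatched nij pK ptwo pP.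
  have rwi := recolour_i nij pK ptwo pP Kp Kr Kt.
  have rwj := recolour_j nij pK ptwo pP Kp Kr Kt.
  rewrite -!factor_degree_count -/(Uw i) -/(Uw j) in degw rwi rwj.
  have leU b : #|K a :&: Uw b| <= #|Uw b| by apply/subset_leq_card/subsetIr.
  have := leU i; have := leU j.
  suff : #|Uw i| = 0 \/ #|Uw j| = 0.
    move: ij ji degw rwi rwj.
    move: (cdeg _ _ w) (cdeg _ _ w) (cdeg _ _ w) (cdeg _ _ w) => x y x' y'.
    by move: #|_| #|_| #|_| #|_| => u1 u2 u3 u4; lia.
  have [->|[d dU]] := set_0Vmem (Uw i); first by rewrite cards0; left.
  have [->|[d' d'U]] := set_0Vmem (Uw j); first by rewrite cards0; right.
  have UwU b e : e \in Uw b -> e \in U b /\ dart_tail e = w.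
    by rewrite !inE => /and3P[-> /eqP ->].
  have [{}dU dw] := UwU _ _ dU; have [{}d'U d'w] := UwU _ _ d'U.
  have [pd cd] := UP _ _ dU; have [pd' cd'] := UP _ _ d'U.
  case/negP: nij; rewrite -cd -cd'; apply/eqP/pmax => //.
  - by rewrite twoU ?dU.
  - by rewrite twoU ?d'U ?orbT.
  - by rewrite dw d'w.
Qed.

End Exchange.

(** * Equitable shares *)


(** This is |x - n / k| < 1, cleared of denominators and subtractions. *)
Definition equitable_share (k n x : nat) : bool :=
  (k * x < n + k) && (n < k * x + k).

Section Shares.
Variable k : nat.

Lemma sum_bool (b : pred 'I_k) : \sum_i (b i : nat) = #|[set i | b i]|.
Proof.
rewrite -sum1dep_card [RHS]big_mkcond.
by apply: eq_bigr => i _; case: (b i).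
Qed.

(** Summing the hypothesis over all indices compares [k * x i] with the total; the term of [i]
    itself makes the inequality strict. *)
Lemma equitable_share_near (x : 'I_k -> nat) i :
  (forall i j, x i <= (x j).+1) -> equitable_share k (\sum_i x i) (x i).
Proof.
move=> near; have E a : k * a = \sum_(j < k) a by rewrite sum_nat_const card_ord.
have SkD : \sum_j x j + k = \sum_j (x j).+1.
  transitivity (\sum_j x j + \sum_(j < k) 1); first by rewrite sum1_card card_ord.
  by rewrite -big_split; apply: eq_bigr => j _; apply: addn1.
apply/andP; split.
  rewrite SkD E (bigD1 i) //= [ltnRHS](bigD1 i) //= -addSn leq_add //.
  by apply: leq_sum.
have SkE : k * x i + k = \sum_(j < k) (x i).+1 by rewrite -mulnSr E.
rewrite SkE (bigD1 i) //= [ltnRHS](bigD1 i) //= -addSn leq_add //.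
by apply: leq_sum.
Qed.

(* If both [a] and [a + 2] occurred among the [x i], the number of odd [x i] would
   not be the number of odd parts in an equitable distribution of the sum. *)
Lemma equitable_share_parity (x t : 'I_k -> nat) n i :
  \sum_i x i = n -> \sum_i t i = n -> (forall i, equitable_share k n (t i)) ->
  #|[set i | odd (x i)]| = #|[set i | odd (t i)]| ->
  (forall i j, x i <= x j + 2) -> equitable_share k n (x i).
Proof.
move=> Sx St teq odd_eq near.
suff : forall i j, x i <= (x j).+1.
  by move=> h; rewrite -Sx; apply: equitable_share_near.
case: (@arg_minnP _ i xpredT x isT) => m _ xmin; set a := x m in xmin.
pose n1 := \sum_i (x i == a.+1 : nat); pose n2 := \sum_i (x i == a.+2 : nat).
have xE j : x j = a + (x j == a.+1) + 2 * (x j == a.+2).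
  by have := xmin j isT; have := near j m; rewrite -/a; lia.
have Sk : \sum_(j < k) 1 = k by rewrite sum1_card card_ord.
have ndef : n = k * a + n1 + 2 * n2.
  rewrite -Sx (eq_bigr _ (fun j _ => xE j)) 2!big_split /= /n2 big_distrr /=.
  by rewrite sum_nat_const card_ord.
have n12 : n1 + n2 < \sum_(j < k) 1.
  rewrite -big_split /= (bigD1 m) //= [ltnRHS](bigD1 m) //=.
  rewrite -addSn leq_add //; first by rewrite -/a; lia.
  by apply: leq_sum => j _; lia.
rewrite Sk in n12.
have oddx : #|[set i | odd (x i)]| = if odd a then k - n1 else n1.
  rewrite -sum_bool; case: ifP => oa; last first.
    by apply: eq_bigr => j _; rewrite (xE j); lia.
  suff : \sum_i (odd (x i) : nat) + n1 = \sum_(j < k) 1 by rewrite Sk; lia.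
  rewrite -big_split; apply: eq_bigr => j _ /=; have := xE j; lia.
have k_gt0 : 0 < k by lia.
set q := n %/ k; set r := n %% k.
have nqr : n = q * k + r by apply: divn_eq.
have rk : r < k by apply: ltn_pmod.
have tE j : t j = q + (t j == q.+1).
  case/andP: (teq j) => h1 h2; have : q <= t j <= q.+1 by nia.
  by lia.
have Str : \sum_i (t i == q.+1 : nat) = r.
  move: St; rewrite (eq_bigr _ (fun j _ => tE j)) big_split /=.
  by rewrite sum_nat_const card_ord nqr; lia.
have oddt : #|[set i | odd (t i)]| = if odd q then k - r else r.
  rewrite -sum_bool -Str; case: ifP => oq; last first.
    by apply: eq_bigr => j _; rewrite (tE j); lia.
  suff : \sum_i (odd (t i) : nat) + \sum_i (t i == q.+1 : nat) = \sum_(j < k) 1.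
    by rewrite Sk; lia.
  rewrite -big_split; apply: eq_bigr => j _ /=; have := tE j; lia.
(* Since n1 + 2 * n2 < 2 * k, [q] is [a] or [a.+1]. In the first case equal numbers of odd parts
   give r = n1. In the second they give n1 = k - r and n2 = r, contradicting n1 + n2 < k. *)
have n20 : n2 = 0.
  have [qa|qa] : q = a \/ q = a.+1 by nia.
    have : r = n1 + 2 * n2 by nia.
    by move: odd_eq; rewrite oddx oddt qa; case: ifP; lia.
  have : r + k = n1 + 2 * n2 by nia.
  by move: odd_eq; rewrite oddx oddt qa /=; case: (odd a) => /=; lia.
have xle j : x j <= a.+1.
  suff : x j != a.+2 by have := xE j; lia.
  apply/negP=> xj; move: n20; rewrite /n2 (bigD1 j) //= xj; lia.
by move=> j1 j2; have := xle j1; have := xmin j2 isT; lia.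
Qed.

(* [residue_count i n] is the number of [m < n] with [m = i %[mod k]]. *)
Definition residue_count (i : 'I_k) (n : nat) := (n + (k.-1 - i)) %/ k.

Lemma residue_countD i m n :
  residue_count i (m * k + n) = m + residue_count i n.
Proof. by rewrite /residue_count -addnA divnMDl //; case: (k) i => // -[]. Qed.

Lemma residue_countS i n :
  residue_count i n.+1 = residue_count i n + (n %% k == i).
Proof.
have k_gt0 : 0 < k by case: (k) i => // -[].
have ik := ltn_ord i; have nk := ltn_pmod n k_gt0.
rewrite {1 2}(divn_eq n k) -addnS !residue_countD -addnA; congr (_ + _).
rewrite /residue_count; move: (n %% k) nk => r rk.
have [ri|ri|ri] := ltngtP r i.
- by rewrite !divn_small; lia.
- rewrite [r.+1 + _](_ : _ = 1 * k + (r - i)); last by lia.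
  rewrite [r + _](_ : _ = 1 * k + (r - i.+1)); last by lia.
  by rewrite !divnMDl // !divn_small; lia.
rewrite [r.+1 + _](_ : _ = 1 * k + 0); last by lia.
by rewrite divnMDl // !divn_small; lia.
Qed.

Lemma sum_residue_count n : 0 < k -> \sum_i residue_count i n = n.
Proof.
move=> k_gt0; elim: n => [|n IH].
  by apply: big1 => i _; rewrite /residue_count divn_small //; lia.
rewrite (eq_bigr _ (fun i _ => residue_countS i n)) big_split /= IH.
rewrite (bigD1 (Ordinal (ltn_pmod n k_gt0))) //= eqxx big1 ?addn0 ?addn1 //.
by move=> i; rewrite -val_eqE /= eq_sym => /negPf->.
Qed.

(** Two reals at distance n / k have floors whose difference is within less than 1 of n / k. *)
Lemma residue_count_share i m n :
  residue_count i m <= residue_count i (m + n) /\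
  equitable_share k n (residue_count i (m + n) - residue_count i m).
Proof.
have k_gt0 : 0 < k by case: (k) i => // -[].
rewrite /residue_count /equitable_share; set c := k.-1 - i.
have := divn_eq (m + c) k; have := ltn_pmod (m + c) k_gt0.
have := divn_eq (m + n + c) k; have := ltn_pmod (m + n + c) k_gt0.
have le : (m + c) %/ k <= (m + n + c) %/ k by apply: leq_div2r; lia.
split=> //; nia.
Qed.

End Shares.

(** The elements of [s] occupy consecutive intervals from [m] on, so the increments of
    [residue_count] telescope. *)
Lemma equitable_layout (V : finType) (k : nat) (d : V -> nat) (s : seq V) m :
  0 < k -> uniq s -> exists t : 'I_k -> V -> nat,
    {in s, forall v, \sum_i t i v = d v /\ forall i, equitable_share k (d v) (t i v)}
    /\ forall i, residue_count i m + \sum_(v <- s) t i v =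
         residue_count i (m + \sum_(v <- s) d v).
Proof.
move=> k_gt0; elim: s m => [|v s IH] m /=.
  by move=> _; exists (fun _ _ => 0); split=> // i; rewrite !big_nil !addn0.
case/andP=> vs /(IH (m + d v)) [t [ts tS]].
exists (fun i u => if u == v then residue_count i (m + d v) - residue_count i m
  else t i u); split=> [u|i].
  rewrite inE; have [->|uv] := eqVneq u v => [_|]; last exact: ts.
  split=> [|i]; last by have [] := residue_count_share i m (d v).
  have le i := (residue_count_share i m (d v)).1.
  have : \sum_(i < k) (residue_count i (m + d v) - residue_count i m)
      + \sum_(i < k) residue_count i m = \sum_(i < k) residue_count i (m + d v).
    by rewrite -big_split; apply: eq_bigr => i _; rewrite /= subnK.
  by rewrite /= !sum_residue_count //; lia.
rewrite !big_cons eqxx [m + (_ + _)]addnA -tS addnA subnKC;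
  last by have [] := residue_count_share i m (d v).
congr (_ + _); rewrite !big_seq; apply: eq_bigr => u us.
by case: eqP => // uv; rewrite -uv us in vs.
Qed.

Section Colourings.
Variables (G : multigraph) (k : nat).
Implicit Types (c : edge G -> 'I_k) (v w : vertex G).
Local Notation cdeg c a w := (factor_degree (colour_class c a) w).

Lemma sum_degree : \sum_(v : vertex G) degree v = #|edge G|.*2.
Proof. by rewrite sum_factor_degree cardsT. Qed.

(* The vertices of [Z], and the others, are laid out one after the other along the
   integers; the share of colour [i] at a vertex counts the integers congruent to
   [i] in its interval.  The two lengths sum to [2 * #|edge G|] and differ by an
   even multiple of [k]. *)
Lemma even_shares (Z : {set vertex G}) : 0 < k ->
  #|edge G| = \sum_(v in Z) degree v %[mod k] ->
  exists t : 'I_k -> vertex G -> nat,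
  [/\ forall v, \sum_i t i v = degree v,
      forall i v, equitable_share k (degree v) (t i v)
    & forall i, ~~ odd (\sum_v t i v)].
Proof.
move=> k_gt0 hZ.
have [t1 [t1Z t1S]] := equitable_layout (@degree G) 0 k_gt0 (enum_uniq Z).
have [t2 [t2Z t2S]] := equitable_layout (@degree G) 0 k_gt0 (enum_uniq (~: Z)).
exists (fun i v => if v \in Z then t1 i v else t2 i v); split.
- move=> v; case vZ: (v \in Z); first by have [] := t1Z v; rewrite ?mem_enum.
  by have [] := t2Z v; rewrite ?mem_enum ?inE ?vZ.
- move=> i v; case vZ: (v \in Z); first by have [] := t1Z v; rewrite ?mem_enum.
  by have [] := t2Z v; rewrite ?mem_enum ?inE ?vZ.
move=> i.
have DE : \sum_(v in Z) degree v + \sum_(v in ~: Z) degree v = #|edge G|.*2.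
  rewrite -sum_degree [RHS](bigID (mem Z)) /=; congr (_ + _).
  by apply: eq_bigl => v; rewrite inE.
rewrite (bigID (mem Z)) /= (eq_bigr (t1 i)) => [|v ->//].
rewrite [X in odd (_ + X)](_ : _ = \sum_(v in ~: Z) t2 i v); last first.
  by apply: eq_big => v; rewrite ?inE // => /negPf->.
have := t1S i; have := t2S i; rewrite !big_enum /= !add0n.
have -> : residue_count i 0 = 0 by rewrite /residue_count divn_small //; lia.
rewrite !add0n; move: (\sum_(v in Z) degree v) hZ (\sum_(v in ~: Z) degree v) DE.
move=> D2 hZ D1 DE -> ->.
(* The lengths differ by 2 * m * k, so their residue counts differ by 2 * m and have an even sum. *)
move/eqP: hZ; case: (leqP D2 #|edge G|) => le.
  rewrite (eqn_mod_dvd _ le) => /dvdnP[m mE].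
  have -> : D1 = m.*2 * k + D2 by lia.
  by rewrite residue_countD; lia.
rewrite eq_sym (eqn_mod_dvd _ (ltnW le)) => /dvdnP[m mE].
have -> : D2 = m.*2 * k + D1 by lia.
by rewrite residue_countD; lia.
Qed.

End Colourings.

(** * Colourings with prescribed parities *)


Lemma sum_split2 (I : finType) (i j : I) (f : I -> nat) : i != j ->
  \sum_a f a = f i + f j + \sum_(a | (a != i) && (a != j)) f a.
Proof. by move=> ij; rewrite (bigD1 i) //= (bigD1 j) 1?eq_sym //= addnA. Qed.

(** The sum of the squares is the square of the fixed sum minus twice the product, which is what
    [exchange_degree] controls. *)
Lemma sum_squares x y x' y' : x' + y' = x + y ->
  (x' * x' + y' * y' <= x * x + y * y) = (x * y <= x' * y') /\
  (x' * x' + y' * y' < x * x + y * y) = (x * y < x' * y').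
Proof.
move=> s; have : (x' + y') * (x' + y') = (x + y) * (x + y) by rewrite s.
by split; apply/idP/idP; nia.
Qed.

Lemma eq_odd_sum (I : finType) (f g : I -> nat) :
  (forall i, odd (f i) = odd (g i)) -> odd (\sum_i f i) = odd (\sum_i g i).
Proof.
move=> fg; apply: (big_ind2 (fun a b : nat => odd a = odd b)) => // a b a' b'.
by rewrite !oddD => -> ->.
Qed.

Lemma ltn_sum (I : finType) (i : I) (f g : I -> nat) :
  (forall a, f a <= g a) -> f i < g i -> \sum_a f a < \sum_a g a.
Proof.
move=> fg lti; rewrite (bigD1 i) //= [ltnRHS](bigD1 i) //= -addSn leq_add //.
exact: leq_sum.
Qed.

Section Colourings.
Variables (G : multigraph) (k : nat).
Implicit Types (c : edge G -> 'I_k) (v w : vertex G).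
Local Notation cdeg c a w := (factor_degree (colour_class c a) w).

Lemma colour_class_ffun c a : colour_class (finfun c) a = colour_class c a.
Proof. by apply/setP=> e; rewrite !inE ffunE. Qed.

Lemma sum_colour_degree c v : \sum_a cdeg c a v = degree v.
Proof.
rewrite /degree factor_degreeE -sum1_card.
rewrite (partition_big (fun d : edge G * bool => c d.1) xpredT) //=.
apply: eq_bigr => a _; rewrite factor_degreeE -sum1_card.
by apply: eq_bigl => d; rewrite !inE andbC.
Qed.

Lemma sum_card_class c : \sum_a #|colour_class c a| = #|edge G|.
Proof.
rewrite -sum1_card (partition_big c xpredT) //=.
by apply: eq_bigr => a _; rewrite -sum1_card; apply: eq_bigl => e; rewrite !inE.
Qed.

Definition equitable_colouring c :=
  forall i v, equitable_share k (degree v) (cdeg c i v).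

Lemma equitable_colouring_of_parity c (t : 'I_k -> vertex G -> nat) :
  (forall v, \sum_i t i v = degree v) ->
  (forall i v, equitable_share k (degree v) (t i v)) ->
  (forall i v, odd (cdeg c i v) = odd (t i v)) ->
  exists c', equitable_colouring c'.
Proof.
move=> tS teq ct.
(* Only the number of odd degrees is kept: where one of the two degrees is odd and the other even, a
   swap may interchange their parities. *)
pose P (c : {ffun edge G -> 'I_k}) := [forall v,
  \sum_i (odd (cdeg c i v) : nat) == \sum_i (odd (t i v) : nat)].
pose Phi (c : {ffun edge G -> 'I_k}) := \sum_v \sum_i cdeg c i v * cdeg c i v.
have P0 : P (finfun c).
  apply/forallP=> v; apply/eqP/eq_bigr => i _.
  by rewrite colour_class_ffun ct.
case: (@arg_minnP _ _ P Phi P0) => c1 /forallP Pc1 c1min.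
exists c1 => i v.
apply: (equitable_share_parity (x := fun i => cdeg c1 i v) (t := t^~ v)) => //.
- exact: sum_colour_degree.
- rewrite -(sum_bool (fun i => odd (cdeg c1 i v))) -(sum_bool (fun i => odd (t i v))).
  exact/eqP/Pc1.
move=> a b; rewrite leqNgt; apply/negP=> lt.
have ab : a != b by apply: contraTneq lt => ->; lia.
have [c2 [oth sum_eq prod_le prod_lt par]] := exchange_degree ab lt.
have P2 : P (finfun c2).
  apply/forallP=> w; rewrite -(eqP (Pc1 w)); apply/eqP.
  rewrite !(sum_split2 _ ab) !colour_class_ffun; congr (_ + _).
    have := sum_eq w; have := par w.
    move: (cdeg c1 a w) (cdeg c1 b w) (cdeg c2 a w) (cdeg c2 b w) => x y x' y'.
    move=> + /(congr1 odd); rewrite !oddD.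
    by case: (odd x); case: (odd y); case: (odd x'); case: (odd y') => // /(_ isT).
  by apply: eq_bigr => d /andP[da db]; rewrite colour_class_ffun oth.
have := c1min _ P2; rewrite leqNgt => /negP; apply; rewrite /Phi.
have E w (f : {ffun edge G -> 'I_k}) := sum_split2 (fun i => cdeg f i w * cdeg f i w) ab.
have eqo w : \sum_(d | (d != a) && (d != b)) cdeg (finfun c2) d w * cdeg (finfun c2) d w
    = \sum_(d | (d != a) && (d != b)) cdeg c1 d w * cdeg c1 d w.
  by apply: eq_bigr => d /andP[da db]; rewrite colour_class_ffun oth.
apply: (@ltn_sum _ v) => [w|]; rewrite !E eqo !colour_class_ffun.
  by rewrite leq_add2r (sum_squares (sum_eq w)).1.
by rewrite ltn_add2r (sum_squares (sum_eq v)).2.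
Qed.

Lemma equitable_class_sizes c : equitable_colouring c ->
  exists c', equitable_colouring c' /\
    forall i, equitable_share k #|edge G| #|colour_class c' i|.
Proof.
move=> eqc.
pose P (c : {ffun edge G -> 'I_k}) :=
  [forall i, forall v, equitable_share k (degree v) (cdeg c i v)].
pose Phi (c : {ffun edge G -> 'I_k}) :=
  \sum_i #|colour_class c i| * #|colour_class c i|.
have P0 : P (finfun c).
  by apply/forallP=> i; apply/forallP=> v; rewrite colour_class_ffun.
case: (@arg_minnP _ _ P Phi P0) => c1 /forallP Pc1 c1min.
have eq1 : equitable_colouring c1 by move=> i v; apply: (forallP (Pc1 i)).
exists c1; split=> // i; rewrite -(sum_card_class c1).
apply: (equitable_share_near (x := fun i => #|colour_class c1 i|)) => {i} a b.
rewrite leqNgt; apply/negP=> lt.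
have ab : a != b by apply: contraTneq lt => ->; lia.
have near w : cdeg c1 a w <= (cdeg c1 b w).+1 /\ cdeg c1 b w <= (cdeg c1 a w).+1.
  by case/andP: (eq1 a w) => h1 h2; case/andP: (eq1 b w) => h3 h4; split; nia.
have [c2 [oth deg sa sb]] := exchange_size ab near lt.
have P2 : P (finfun c2).
  apply/forallP=> i; apply/forallP=> w; rewrite colour_class_ffun.
  have [->|ia] := eqVneq i a; first by case: (deg w) => -[-> _]; apply: eq1.
  have [->|ib] := eqVneq i b; first by case: (deg w) => -[_ ->]; apply: eq1.
  by rewrite oth //; apply: eq1.
have := c1min _ P2; rewrite leqNgt => /negP; apply; rewrite /Phi.
rewrite !(sum_split2 _ ab) !colour_class_ffun.
rewrite (eq_bigr (fun i => #|colour_class c1 i| * #|colour_class c1 i|)).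
  by rewrite ltn_add2r; move: lt sa sb; move: #|_| #|_| #|_| #|_|; nia.
by move=> i /andP[ia ib]; rewrite colour_class_ffun oth.
Qed.

End Colourings.

(** * Edge sets with prescribed odd vertices *)

Section Joins.
Variable G : multigraph.
Implicit Types (F J H : {set edge G}) (T : {set vertex G}).

Definition symdiff F J := (F :\: J) :|: (J :\: F).

Lemma odd_degree_symdiff F J v : odd (factor_degree (symdiff F J) v) =
  odd (factor_degree F v) (+) odd (factor_degree J v).
Proof.
pose D (F : {set edge G}) := [set d : edge G * bool | (d.1 \in F) && (dart_tail d == v)].
rewrite !factor_degreeE -!/(D _) -(cardsID (D J) (D F)) -(cardsID (D F) (D J)).
have -> : #|D (symdiff F J)| = #|D F :\: D J| + #|D J :\: D F|.
  rewrite -cardsUI [X in _ + X](_ : _ = 0) ?addn0.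
    apply: eq_card => d; rewrite !inE.
    by case: (d.1 \in F); case: (d.1 \in J); case: (_ == v).
  apply/eqP; rewrite cards_eq0; apply/eqP/setP=> d; rewrite !inE.
  by case: (d.1 \in F); case: (d.1 \in J); case: (_ == v).
by rewrite [D J :&: _]setIC; lia.
Qed.

Lemma symdiff_sub F J H : F \subset H -> J \subset H -> symdiff F J \subset H.
Proof. by move=> FH JH; rewrite subUset !(subset_trans (subsetDl _ _)). Qed.

Lemma factor_degree0 v : factor_degree (set0 : {set edge G}) v = 0.
Proof.
by rewrite factor_degreeE; apply/eqP; rewrite cards_eq0; apply/eqP/setP=> d;
  rewrite !inE.
Qed.

(** The edges of a walk are added modulo 2, so repetitions cancel. *)
Lemma path_join F x y : connect (adjacent F) x y -> exists J : {set edge G},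
  J \subset F /\ forall v, odd (factor_degree J v) = (v == x) (+) (v == y).
Proof.
case/connectP=> p; elim: p x => [|z p IH] x /=.
  by move=> _ ->; exists set0; rewrite sub0set; split=> // v; rewrite factor_degree0 addbb.
case/andP=> /existsP[e /andP[eF exz]] /IH /[apply] -[J [JF Jv]].
exists (symdiff [set e] J); split; first by rewrite symdiff_sub ?sub1set.
move=> v; rewrite odd_degree_symdiff Jv addbA; congr (_ (+) _).
have -> : odd (factor_degree [set e] v) = (v == x) (+) (v == z).
  have card1 (a : bool) : #|[set e' in [set e] | a]| = a.
    case: a; last first.
      by apply/eqP; rewrite cards_eq0; apply/eqP/setP => e'; rewrite !inE andbF.
    transitivity #|[set e]|; last exact: cards1.
    by apply: eq_card => e'; rewrite !inE andbT.
  have E (f : edge G -> vertex G) : #|[set e' in [set e] | f e' == v]| = (f e == v).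
    rewrite -(card1 (f e == v)); apply: eq_card => e'; rewrite !inE.
    by case: eqP => // ->.
  rewrite /factor_degree !E oddD !oddb ![v == _]eq_sym.
  by case/orP: exz => /eqP->; rewrite // addbC.
by rewrite addbK.
Qed.

(** The vertices of [T] are paired off arbitrarily and walks between partners are added modulo 2. *)
Lemma connected_join F T : connected F -> ~~ odd #|T| -> exists J : {set edge G},
  J \subset F /\ forall v, odd (factor_degree J v) = (v \in T).
Proof.
move=> Fcon; have [n] := ubnP #|T|; elim: n T => // n IH T ltn evT.
have [->|[x xT]] := set_0Vmem T.
  by exists set0; rewrite sub0set; split=> // v; rewrite factor_degree0 inE.
have cT := cardsD1 x T; rewrite xT in cT.
have [T0|[y yT]] := set_0Vmem (T :\ x); first by rewrite cT T0 cards0 in evT.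
have cT' := cardsD1 y (T :\ x); rewrite yT in cT'.
have [||J [JF Jv]] := IH (T :\ x :\ y); try lia.
have [J' [J'F J'v]] := path_join (Fcon x y).
exists (symdiff J J'); split; first exact: symdiff_sub.
move=> v; rewrite odd_degree_symdiff Jv J'v !inE.
move: yT; rewrite !inE => /andP[yx yT].
have [->|vy] := eqVneq v y; first by rewrite (negPf yx) yT.
by have [->|vx] := eqVneq v x; rewrite ?xT //= ?addbF.
Qed.

End Joins.

Lemma parity_colouring (G : multigraph) (m : nat) (F : 'I_m -> {set edge G})
    (t : 'I_m.+1 -> vertex G -> nat) :
  pairwise_edge_disjoint F -> (forall i, connected (F i)) ->
  (forall v, \sum_i t i v = degree v) -> (forall i, ~~ odd (\sum_v t i v)) ->
  exists c : edge G -> 'I_m.+1,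
    forall i v, odd (factor_degree (colour_class c i) v) = odd (t i v).
Proof.
move=> Fdis Fcon tS tE.
have /fin_all_exists[J JP] : forall i : 'I_m, exists J : {set edge G}, J \subset F i /\
    forall v, odd (factor_degree J v) = odd (t (lift ord0 i) v).
  move=> i.
  have [|J [JF Jv]] := @connected_join G _ [set v | odd (t (lift ord0 i) v)] (Fcon i).
    have -> : odd #|[set v | odd (t (lift ord0 i) v)]| = odd (\sum_v t (lift ord0 i) v).
      rewrite -sum1dep_card big_mkcond /=; apply: eq_odd_sum => v.
      by case: (odd (t _ v)).
    exact: tE.
  by exists J; split=> // v; rewrite Jv inE.
pose c e := if [pick i | e \in J i] is Some i then lift ord0 i else ord0.
have cJ i : colour_class c (lift ord0 i) = J i.
  apply/setP=> e; rewrite inE /c; case: pickP => [i' ei'|none]; last first.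
    by rewrite none eq_liftF.
  rewrite (inj_eq lift_inj); apply/eqP/idP => [<-//|ei].
  apply/eqP; apply: contraTT ei => ii'.
  have /pred0P/(_ e)/= := Fdis _ _ ii'.
  rewrite (subsetP (JP i').1 e ei') /= => eFi; apply/negP => ei.
  by rewrite (subsetP (JP i).1 e ei) in eFi.
exists c => i v; have [j ->|->] := unliftP ord0 i; first by rewrite cJ (JP j).2.
have := sum_colour_degree c v; rewrite -(tS v) !big_ord_recl => h.
have : odd (\sum_(i < m) factor_degree (colour_class c (lift ord0 i)) v) =
   odd (\sum_(i < m) t (lift ord0 i) v).
  by apply: eq_odd_sum => i'; rewrite cJ (JP i').2.
by move/(congr1 odd): h; rewrite !oddD => h1 h2; move: h1; rewrite h2 => /addIb.
Qed.

(** * Connectivity and exchanges *)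


Section Representatives.
Variable V : finType.
Implicit Types (R : rel V) (x y r : V).

(** With the element of least rank representing its class, coarsening the relation only removes
    representatives. *)
Definition class_reps R : {set V} :=
  [set x | [forall y, R x y ==> (enum_rank x <= enum_rank y)]].

Section Equivalence.
Variable R : rel V.
Hypotheses (Rrefl : reflexive R) (Rsym : symmetric R) (Rtrans : transitive R).

Lemma class_rep_exists x : exists2 r, r \in class_reps R & R x r.
Proof.
case: (@arg_minnP _ x (R x) (fun y => nat_of_ord (enum_rank y)) (Rrefl x)) => r xr rmin.
exists r => //; rewrite inE; apply/forallP=> y; apply/implyP=> ry.
exact/rmin/(Rtrans xr).
Qed.

Lemma class_rep_inj : {in class_reps R &, forall r r', R r r' -> r = r'}.
Proof.
move=> r r'; rewrite !inE => /forallP/(_ r')/implyP rm /forallP/(_ r)/implyP rm' rr'.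
apply/enum_rank_inj/val_inj/eqP; rewrite eqn_leq rm //=.
by rewrite rm' // Rsym.
Qed.

Lemma class_reps_gt0 : 0 < #|V| -> 0 < #|class_reps R|.
Proof.
case/card_gt0P=> x _; have [r rR _] := class_rep_exists x.
by apply/card_gt0P; exists r.
Qed.

Lemma class_reps_le1 x y : #|class_reps R| <= 1 -> R x y.
Proof.
have [r rR xr] := class_rep_exists x; have [r' r'R yr'] := class_rep_exists y.
move/card_le1_eqP => /(_ r r' rR r'R) rr'; apply: Rtrans xr _.
by rewrite Rsym -rr' in yr' *.
Qed.

End Equivalence.

Lemma class_reps_sub R R' : subrel R R' -> class_reps R' \subset class_reps R.
Proof.
move=> RR'; apply/subsetP=> x; rewrite !inE => /forallP h; apply/forallP=> y.
by apply/implyP=> /RR'; apply/implyP.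
Qed.

Lemma class_reps_proper R R' x y :
  reflexive R -> symmetric R -> transitive R ->
  reflexive R' -> symmetric R' -> transitive R' ->
  subrel R R' -> R' x y -> ~~ R x y -> #|class_reps R'| < #|class_reps R|.
Proof.
move=> Rr Rs Rt Rr' Rs' Rt' RR' xy nxy.
have [rx rxR xrx] := class_rep_exists Rr Rt x.
have [ry ryR yry] := class_rep_exists Rr Rt y.
have rxy : R' rx ry.
  apply: (Rt' y); last exact: RR'.
  by apply: (Rt' x) => //; rewrite Rs'; apply: RR'.
apply/proper_card/properP; split; first exact: class_reps_sub.
case: (boolP (rx \in class_reps R')) => [rxR'|]; last by exists rx.
exists ry => //; apply/negP=> ryR'.
have rr := class_rep_inj Rs' rxR' ryR' rxy.
by case/negP: nxy; apply: Rt xrx _; rewrite rr Rs.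
Qed.

End Representatives.

Section Connectivity.
Variable G : multigraph.
Implicit Types (F A B : {set edge G}) (e f : edge G) (x y u w : vertex G).
Local Notation joined F := (connect (adjacent F)).
Local Notation comps F := #|class_reps (joined F)|.

Lemma joined_sym F : symmetric (joined F).
Proof.
apply: sym_connect_sym => x y; apply: eq_existsb => e.
by rewrite orbC.
Qed.

Lemma joined_trans F : transitive (joined F).
Proof. by move=> y x z; apply: connect_trans. Qed.

Lemma joined_ends F e : e \in F -> joined F (ends e).1 (ends e).2.
Proof.
move=> eF; apply: connect1; apply/existsP; exists e.
by rewrite eF -surjective_pairing eqxx.
Qed.

Lemma joined_sub F A : (forall e, e \in F -> joined A (ends e).1 (ends e).2) ->
  subrel (joined F) (joined A).
Proof.
move=> FA; apply: connect_sub => x y /existsP[e /andP[/FA eA /orP[]]] /eqP exy.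
  by rewrite exy in eA.
by rewrite exy joined_sym in eA.
Qed.

Lemma joined_subset F A : F \subset A -> subrel (joined F) (joined A).
Proof. by move/subsetP=> FA; apply: joined_sub => e /FA/joined_ends. Qed.

Lemma comps_subset F A : F \subset A -> comps A <= comps F.
Proof. by move/joined_subset=> FA; apply/subset_leq_card/class_reps_sub. Qed.

Lemma comps_proper F A x y : F \subset A -> joined A x y -> ~~ joined F x y ->
  comps A < comps F.
Proof.
move=> FA; apply: class_reps_proper; try exact: connect0;
  try exact: joined_sym; try exact: joined_trans.
exact: joined_subset.
Qed.

Lemma joined_setU1 e F x y : joined (e |: F) x y ->
  [\/ joined F x y, joined F x (ends e).1 /\ joined F (ends e).2 y
    | joined F x (ends e).2 /\ joined F (ends e).1 y].
Proof.
case/connectP=> p; elim: p x => [|z p IH] x /= .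
  by move=> _ ->; constructor 1.
case/andP=> /existsP[f /andP[]]; rewrite in_setU1 => /predU1P[->|fF] exz /IH /[apply].
  case/orP: exz => /eqP-> /=.
    by case=> [|[]|[]]; [constructor 2 | constructor 2 | constructor 1].
  by case=> [|[]|[]]; [constructor 3 | constructor 1 | constructor 3].
have xz : joined F x z by apply: connect1; apply/existsP; exists f; rewrite fF.
by case=> [h|[h h']|[h h']]; [constructor 1|constructor 2|constructor 3];
  rewrite ?h' //; try split=> //; apply: connect_trans h.
Qed.

(* In a minimal set joining [x] to [y], every edge can be traded for an edge
   from [x] to [y]. *)
Lemma exchange_on_path F x y : joined F x y ->
  exists2 B : {set edge G}, B \subset F & joined B x y /\
    forall e f, e \in B -> ends f = (x, y) -> joined (f |: F :\ e) =2 joined F.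
Proof.
move=> Fxy.
pose P (B : {set edge G}) := (B \subset F) && joined B x y.
have P0 : P F by rewrite /P subxx.
case: (@arg_minnP _ F P (fun B : {set edge G} => #|B|) P0) => B /andP[BF Bxy] Bmin.
exists B => //; split=> // e f eB fxy.
have xyf : joined (f |: F :\ e) x y.
  by have := @joined_ends (f |: F :\ e) f; rewrite fxy; apply; rewrite setU11.
have sub : B :\ e \subset f |: F :\ e.
  by apply: subset_trans (subsetUr _ _); apply: setSD.
have e_joined : joined (f |: F :\ e) (ends e).1 (ends e).2.
  have nBe : ~~ joined (B :\ e) x y.
    apply/negP=> h; have := Bmin (B :\ e).
    rewrite /P h andbT (subset_trans (subsetDl _ _) BF) => /(_ isT).
    by rewrite (cardsD1 e B) eB; lia.
  have := Bxy; rewrite -(setD1K eB) => /joined_setU1[h|[xu wy]|[xw uy]].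
  - by rewrite h in nBe.
  - have := joined_subset sub xu; have := joined_subset sub wy.
    rewrite joined_sym => yw; rewrite joined_sym => ux.
    exact: connect_trans (connect_trans ux xyf) yw.
  - have xw' := joined_subset sub xw; have uy' := joined_subset sub uy.
    have yxf : joined (f |: F :\ e) y x by rewrite joined_sym.
    exact: connect_trans (connect_trans uy' yxf) xw'.
move=> u w; apply/idP/idP; apply: joined_sub => g.
  rewrite !inE => /predU1P[->|/andP[_ gF]]; last exact: joined_ends.
  by rewrite fxy.
move=> gF; have [->//|ge] := eqVneq g e.
by apply: joined_ends; rewrite !inE ge gF orbT.
Qed.

End Connectivity.

(** * Packing connected spanning subgraphs *)


Lemma connect_ind (T : finType) (e : rel T) (P : T -> Prop) x :
  P x -> (forall y z, connect e x y -> P y -> e y z -> P z) ->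
  forall y, connect e x y -> P y.
Proof.
move=> Px Pstep y /connectP[p + ->]; elim/last_ind: p => [|p z IH] //=.
rewrite rcons_path last_rcons => /andP[xp pz]; apply: Pstep (IH xp) pz.
by apply/connectP; exists p.
Qed.

Section Packing.
Variables (G : multigraph) (m : nat).
Implicit Types (F : {ffun 'I_m -> {set edge G}}) (A : {set edge G}).
Implicit Types (e f : edge G) (x y : vertex G).
Local Notation joined A := (connect (adjacent A)).
Local Notation comps A := #|class_reps (joined A)|.

Lemma eq_comps (A B : {set edge G}) : joined A =2 joined B -> comps A = comps B.
Proof.
move=> AB; apply: eq_card => x; rewrite !inE; apply: eq_forallb => y.
by rewrite AB.
Qed.

Definition covered F : {set edge G} := \bigcup_i F i.

Definition disjoint_family F : bool :=
  [forall i, forall j, (i != j) ==> [disjoint F i & F j]].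

Lemma disjoint_familyP F :
  reflect (pairwise_edge_disjoint F) (disjoint_family F).
Proof.
apply: (iffP forallP) => [h i j ij|h i].
  by have /forallP/(_ j)/implyP/(_ ij) := h i.
by apply/forallP=> j; apply/implyP=> ij; apply: h.
Qed.

Definition replace F i (A : {set edge G}) : {ffun 'I_m -> {set edge G}} :=
  [ffun j => if j == i then A else F j].

Lemma disjoint_replace F i A : pairwise_edge_disjoint F ->
  (forall e, e \in A -> e \in F i \/ e \notin covered F) ->
  pairwise_edge_disjoint (replace F i A).
Proof.
move=> Fd AF.
have AFj j : j != i -> [disjoint A & F j].
  move=> ji; apply/pred0P=> e /=; apply/negP=> /andP[/AF eF eFj].
  case: eF => [eFi|/bigcupP[]]; last by exists j.
  by have /pred0P/(_ e)/= := Fd _ _ ji; rewrite eFi eFj.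
move=> j1 j2 j12; rewrite !ffunE.
have [j1i|j1i] := eqVneq j1 i; have [j2i|j2i] := eqVneq j2 i.
- by rewrite j1i j2i eqxx in j12.
- exact: AFj.
- by rewrite disjoint_sym; apply: AFj.
- exact: Fd.
Qed.

Definition trade F F' : bool :=
  [exists i, exists e, exists f, [&& f \notin covered F, e \in F i,
    F' == replace F i (f |: F i :\ e) &
    [forall x, forall y, joined (f |: F i :\ e) x y == joined (F i) x y]]].

Lemma tradeP F F' : trade F F' -> exists i e f,
  [/\ f \notin covered F, e \in F i, F' = replace F i (f |: F i :\ e)
    & joined (f |: F i :\ e) =2 joined (F i)].
Proof.
case/existsP=> i /existsP[e /existsP[f /and4P[fF eF /eqP -> /forallP h]]].
by exists i, e, f; split=> // x y; apply/eqP/(forallP (h x)).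
Qed.

(** The components of these edges form the vertex partition that witnesses a failure to pack
    connected subgraphs. *)
Definition exposed F0 : {set edge G} :=
  [set e | [exists F, connect trade F0 F && (e \notin covered F)]].

Section MinimalFamily.
Variable F0 : {ffun 'I_m -> {set edge G}}.
Hypotheses (F0d : pairwise_edge_disjoint F0)
  (F0min : forall F, pairwise_edge_disjoint F ->
     \sum_i comps (F0 i) <= \sum_i comps (F i)).
Local Notation E0 := (exposed F0).

Lemma reachable_family F : connect trade F0 F ->
  pairwise_edge_disjoint F /\ forall i, joined (F i) =2 joined (F0 i).
Proof.
elim/connect_ind=> // {}F F' _ [Fd Fj] /tradeP[i [e [f [fF eF -> ej]]]].
split=> [|j].
  by apply: disjoint_replace => // g; rewrite !inE => /predU1P[->|/andP[_]]; auto.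
by rewrite ffunE; case: eqP => // -> x y; rewrite ej Fj.
Qed.

(** Otherwise adding [e] to [F i] would lower the total number of components. *)
Lemma joined_uncovered F e i : connect trade F0 F -> e \notin covered F ->
  joined (F i) (ends e).1 (ends e).2.
Proof.
move=> /reachable_family[Fd Fj] eF; apply: contraT => ne.
have : pairwise_edge_disjoint (replace F i (e |: F i)).
  by apply: disjoint_replace => // g; rewrite !inE => /predU1P[->|]; auto.
move/F0min; rewrite leqNgt => /negP[]; apply: (@ltn_sum _ i) => [j|].
  rewrite -(eq_comps (Fj j)) ffunE; case: eqP => [->|//].
  exact/comps_subset/subsetUr.
rewrite -(eq_comps (Fj i)) ffunE eqxx; apply: comps_proper ne.
  exact: subsetUr.
by apply: joined_ends; rewrite setU11.
Qed.

(** Every edge of a minimal connection between the ends of [e] in [F i] can be traded for [e], and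
    is then uncovered itself. *)
Lemma joined_exposed F e i : connect trade F0 F -> e \notin covered F ->
  joined (F i :&: E0) (ends e).1 (ends e).2.
Proof.
move=> F0F eF; have [Fd Fj] := reachable_family F0F.
have [B BF [Bxy Bex]] := exchange_on_path (joined_uncovered i F0F eF).
apply: joined_subset Bxy; rewrite subsetI BF /=; apply/subsetP=> g gB.
have gF := subsetP BF g gB.
rewrite inE; apply/existsP; exists (replace F i (e |: F i :\ g)).
apply/andP; split.
  apply: connect_trans F0F (connect1 _); apply/existsP; exists i.
  apply/existsP; exists g; apply/existsP; exists e; rewrite eF gF eqxx /=.
  apply/forallP=> x; apply/forallP=> y; rewrite Bex //.
  by rewrite -surjective_pairing.
apply/bigcupP=> -[j _]; rewrite ffunE; have [_|ji] := eqVneq j i.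
  rewrite !inE eqxx orbF => /eqP ge; case/negP: eF; rewrite -ge.
  by apply/bigcupP; exists i.
by move=> gFj; have /pred0P/(_ g)/= := Fd _ _ ji; rewrite gF gFj.
Qed.

(** Undoing a trade, the edge that it brought in is replaced by the connection from
    [joined_exposed]. *)
Lemma joined_exposed_back F i : connect trade F0 F ->
  subrel (joined (F i :&: E0)) (joined (F0 i :&: E0)).
Proof.
move=> F0F; elim/connect_ind: F0F i => [i x y //|{}F F' F0F IH].
move=> /tradeP[j [e [f [fF eF -> ej]]]] i x y FE; apply: IH.
apply: joined_sub FE => g; rewrite in_setI ffunE => /andP[gF gE].
case: eqP gF => [->|_] gF; last by apply: joined_ends; rewrite inE gF.
move: gF; rewrite !inE => /predU1P[->|/andP[_ gF]]; first exact: joined_exposed.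
by apply: joined_ends; rewrite inE gF.
Qed.

Lemma joined_in_exposed i : subrel (joined E0) (joined (F0 i :&: E0)).
Proof.
apply: joined_sub => e; rewrite inE => /existsP[F /andP[F0F eF]].
exact/(joined_exposed_back F0F)/joined_exposed.
Qed.

Definition crossing : {set edge G} :=
  [set e | ~~ joined E0 (ends e).1 (ends e).2].

Lemma crossing_covered : crossing \subset covered F0.
Proof.
apply/subsetP=> e; rewrite inE; apply: contraR => eF; apply: joined_ends.
by rewrite inE; apply/existsP; exists F0; rewrite connect0.
Qed.

Hypothesis bridges : forall i e, e \in F0 i ->
  ~~ joined (F0 i :\ e) (ends e).1 (ends e).2.

Lemma card_crossing_part i : 0 < #|vertex G| ->
  #|crossing :&: F0 i| < comps E0.
Proof.
move=> V_gt0.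
(* [F0 i :&: E0] has at most as many components as [E0], and each crossing edge added to it, being a
   bridge of [F0 i], merges two. *)
suff H (Y : {set edge G}) : Y \subset crossing :&: F0 i ->
    #|Y| + comps ((F0 i :&: E0) :|: Y) <= comps E0.
  have := H _ (subxx _); apply: leq_trans; rewrite -addn1 leq_add2l.
  by apply: (class_reps_gt0 _ _ V_gt0); [exact: connect0 | exact: joined_trans].
have [n] := ubnP #|Y|; elim: n Y => // n IH Y ltY Ysub.
have [->|[e eY]] := set_0Vmem Y.
  by rewrite cards0 setU0; apply/subset_leq_card/class_reps_sub/joined_in_exposed.
have Y'sub : Y :\ e \subset crossing :&: F0 i.
  exact: subset_trans (subsetDl _ _) Ysub.
have cY := cardsD1 e Y; rewrite eY in cY.
have IHY : #|Y :\ e| + comps (F0 i :&: E0 :|: Y :\ e) <= comps E0.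
  by apply: IH => //; lia.
have eX := subsetP Ysub e eY; case/setIP: eX => eX eF.
suff : comps (F0 i :&: E0 :|: Y) < comps (F0 i :&: E0 :|: Y :\ e) by lia.
apply: (@comps_proper _ _ _ (ends e).1 (ends e).2).
- by apply: setUS; apply: subsetDl.
- by apply: joined_ends; rewrite inE eY orbT.
apply: contra (bridges eF); apply: joined_subset; apply/subsetP=> g.
rewrite in_setU in_setD1 => /orP[/setIP[gF gE]|/andP[ge gY]].
  rewrite in_setD1 gF andbT; apply: contraTneq gE => ->.
  by apply: contraL eX; rewrite [e \in crossing]inE negbK; apply: joined_ends.
by rewrite in_setD1 ge; have /setIP[] := subsetP Ysub g gY.
Qed.

(** Double counting: at least [l] edges leave each class, and a crossing edge leaves only the
    classes of its two ends. *)
Lemma card_crossing l : edge_connected G l -> 1 < comps E0 ->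
  l * comps E0 <= 2 * #|crossing|.
Proof.
move=> Gl gt1.
pose R := class_reps (joined E0); pose cls r := [set y | joined E0 r y].
have cut_le r : r \in R -> l <= #|edge_cut (cls r)|.
  move=> rR; apply: Gl.
    by apply/set0Pn; exists r; rewrite inE connect0.
  apply/eqP=> clsT; move: gt1; rewrite ltnNge => /negP; apply.
  apply/card_le1_eqP=> r1 r2 r1R r2R.
  have rj u : joined E0 r u by have : u \in cls r; [rewrite clsT | rewrite inE].
  have r12 : joined E0 r1 r2 by apply: connect_trans (rj r2); rewrite joined_sym.
  by rewrite (class_rep_inj (@joined_sym G E0) r1R r2R r12).
rewrite mulnC; apply: (@leq_trans (\sum_(r in R) #|edge_cut (cls r)|)).
  by rewrite -sum_nat_const; apply: leq_sum.
rewrite (eq_bigr (fun r => \sum_e (e \in edge_cut (cls r) : nat))); last first.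
  by move=> r _; rewrite -sum1_card big_mkcond; apply: eq_bigr => e _; case: ifP.
rewrite exchange_big /= mulnC -sum_nat_const [leqRHS]big_mkcond /=.
apply: leq_sum => e _.
have cutP r : e \in edge_cut (cls r) -> e \in crossing /\
    (joined E0 r (ends e).1 || joined E0 r (ends e).2).
  rewrite !inE => ne; split; last by move: ne; case: (joined _ r _); case: (joined _ r _).
  apply: contra ne => j12; apply/eqP; apply/idP/idP => h.
    exact: connect_trans h j12.
  by apply: connect_trans h _; rewrite joined_sym.
case: ifP => [_|eX]; last first.
  by rewrite big1 // => r _; case: (boolP (e \in _)) => // /cutP[]; rewrite eX.
have [r1 r1R xr1] := class_rep_exists (@connect0 _ _) (@joined_trans _ E0) (ends e).1.
have [r2 r2R xr2] := class_rep_exists (@connect0 _ _) (@joined_trans _ E0) (ends e).2.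
apply: (@leq_trans (\sum_(r in R) ((r == r1) + (r == r2)))).
  apply: leq_sum => r rR; case: (boolP (e \in _)) => // /cutP[_ /orP[] h].
    rewrite (class_rep_inj (@joined_sym G E0) rR r1R) ?eqxx //.
    exact: connect_trans h xr1.
  rewrite addnC (class_rep_inj (@joined_sym G E0) rR r2R) ?eqxx //.
  exact: connect_trans h xr2.
rewrite big_split /= (bigD1 r1) //= big1 ?eqxx; last by move=> r /andP[_ /negPf->].
by rewrite (bigD1 r2) //= big1 ?eqxx // => r /andP[_ /negPf->].
Qed.

(* Each F0 i joins the classes of E0 by a forest, so it has fewer crossing edges than
   there are classes; yet all crossing edges are covered, and by edge-connectivity
   there are at least m times as many of them as classes. *)
Lemma minimal_family_connected : edge_connected G (2 * m) ->
  forall i, connected (F0 i).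
Proof.
move=> G2m i x y.
have V_gt0 : 0 < #|vertex G| by apply/card_gt0P; exists x.
have [le1|gt1] := leqP (comps E0) 1.
  apply: joined_subset (subsetIl _ E0) _ _ _; apply: joined_in_exposed.
  by apply: class_reps_le1 le1; [exact: connect0|exact: joined_sym|exact: joined_trans].
have := card_crossing G2m gt1.
have : #|crossing| <= \sum_j #|crossing :&: F0 j|.
  rewrite -{1}(setIidPl crossing_covered) /covered big_distrr /=.
  elim/big_rec2: _ => [|j n A _ leAn]; first by rewrite cards0.
  by apply: leq_trans (leq_add (leqnn _) leAn); rewrite cardsU leq_subr.
have : \sum_j #|crossing :&: F0 j| <= \sum_(j < m) (comps E0).-1.
  by apply: leq_sum => j _; have := card_crossing_part j V_gt0; lia.
rewrite sum_nat_const card_ord; have : 0 < m by case: (m) i => // -[].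
nia.
Qed.

End MinimalFamily.

Lemma connected_packing : edge_connected G (2 * m) ->
  exists F : 'I_m -> {set edge G},
    pairwise_edge_disjoint F /\ forall i, connected (F i).
Proof.
move=> G2m.
pose tot F := \sum_i comps (F i).
have P0 : disjoint_family [ffun=> set0].
  by apply/disjoint_familyP=> i j _; rewrite !ffunE; apply/pred0P=> e; rewrite !inE.
case: (@arg_minnP _ _ disjoint_family tot P0) => F1 F1d F1min.
(* Minimising the number of edges next makes every part a forest, which is the hypothesis
   [bridges]. *)
pose P F := disjoint_family F && (tot F <= tot F1).
have P1 : P F1 by rewrite /P F1d leqnn.
case: (@arg_minnP _ _ P (fun F => \sum_i #|F i|) P1) => F0 /andP[F0d F0tot] F0min.
exists F0; have F0d' := disjoint_familyP _ F0d; split=> //.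
apply: minimal_family_connected => //.
  move=> F /disjoint_familyP Fd; apply: leq_trans F0tot _; exact: F1min.
move=> i e eF; apply/negP=> ej.
have same : joined (F0 i :\ e) =2 joined (F0 i).
  move=> x y; apply/idP/idP; first by apply: joined_subset; apply: subsetDl.
  apply: joined_sub => f fF; have [->//|fe] := eqVneq f e.
  by apply: joined_ends; rewrite !inE fe.
have := F0min (replace F0 i (F0 i :\ e)); rewrite /P.
have -> : disjoint_family (replace F0 i (F0 i :\ e)).
  apply/disjoint_familyP; apply: disjoint_replace => // f.
  by rewrite !inE => /andP[]; auto.
have -> : tot (replace F0 i (F0 i :\ e)) <= tot F1.
  apply: leq_trans F0tot; apply: leq_sum => j _; rewrite ffunE.
  by case: eqP => [->|//]; rewrite (eq_comps same).
move/(_ isT); rewrite leqNgt => /negP; apply; apply: (@ltn_sum _ i) => [j|].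
  by rewrite ffunE; case: eqP => [->|//]; apply/subset_leq_card/subsetDl.
by rewrite ffunE eqxx (cardsD1 e (F0 i)) eF.
Qed.

End Packing.

(** * Equitable decompositions *)


Section Rational.
Import Order.TTheory GRing.Theory Num.Theory.
Local Open Scope ring_scope.

Lemma equitable_share_rat (k n x : nat) : (0 < k)%N -> equitable_share k n x ->
  `|x%:R - n%:R / k%:R| < 1 :> rat.
Proof.
move=> k_gt0 /andP[ub lb]; have k0 : 0 < k%:R :> rat by rewrite ltr0n.
rewrite ltr_distl ltrBlDr ltr_pdivrMr // -ltrBlDr ltr_pdivlMr //.
rewrite mulrBl mulrDl mul1r ltrBlDr -!natrM -!natrD !ltr_nat.
by rewrite !(mulnC x) lb ub.
Qed.

End Rational.

Lemma equitable_decomposition_of_packing (G : multigraph) (m : nat)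
    (Z : {set vertex G}) (F : 'I_m -> {set edge G}) :
  #|edge G| = \sum_(v in Z) degree v %[mod m.+1] ->
  pairwise_edge_disjoint F -> (forall i, connected (F i)) ->
  has_equitable_decomposition G m.+1.
Proof.
move=> hZ Fd Fc.
have [t [tS teq tE]] := even_shares (ltn0Sn m) hZ.
have [c0 c0t] := parity_colouring Fd Fc tS tE.
have [c1 c1eq] := equitable_colouring_of_parity tS teq c0t.
have [c [ceq csize]] := equitable_class_sizes c1eq.
exists (colour_class c); split.
- split=> [i j ij|].
    apply/pred0P=> e /=; rewrite !inE; apply: contraNF ij.
    by case/andP=> /eqP-> .
  apply/setP=> e; rewrite inE; apply/bigcupP.
  by exists (c e); rewrite ?inE.
- by move=> i; apply: equitable_share_rat.
- by move=> i v; apply: equitable_share_rat.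
Qed.

Lemma edge_connected_le (G : multigraph) (l l' : nat) :
  l <= l' -> edge_connected G l' -> edge_connected G l.
Proof. by move=> ll' Gl' X X0 XT; apply: leq_trans ll' (Gl' X X0 XT). Qed.

Lemma tree_connected_packing (G : multigraph) (m n : nat) : m <= n ->
  tree_connected G n -> exists F : 'I_m -> {set edge G},
    pairwise_edge_disjoint F /\ forall i, connected (F i).
Proof.
move=> mn [T [Td Tt]]; exists (fun i => T (widen_ord mn i)); split.
  by move=> i j ij; apply: Td.
by move=> i; case: (Tt (widen_ord mn i)).
Qed.

Theorem theorem3p3 (G : multigraph) (k : nat) (Z : {set vertex G})
    (hk : 0 < k)
    (hZ : #|edge G| = \sum_(v in Z) degree v %[mod k]) :
  (edge_connected G (3 * k - 3) \/ tree_connected G (2 * k - 2) ->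
     has_equitable_decomposition G k) /\
  (loopless G -> edge_connected G (2 * k - 1) ->
     essentially_edge_connected G (3 * k - 3) ->
     has_equitable_decomposition G k).
Proof.
(* With k = m + 1 there are m connected subgraphs to find; 3 * k - 3 = 3 * m and 2 * k - 1 = 2 * m +
   1 are at least the 2 * m of [connected_packing]. *)
case: k hk hZ => // m _ hZ.
have main : (exists F : 'I_m -> {set edge G},
    pairwise_edge_disjoint F /\ forall i, connected (F i)) ->
    has_equitable_decomposition G m.+1.
  by case=> F [Fd Fc]; apply: equitable_decomposition_of_packing hZ Fd Fc.
split=> [[Gc|Gt]|_ Gc _]; apply: main.
- by apply/connected_packing/(edge_connected_le _ Gc); lia.
- by apply: tree_connected_packing Gt; lia.
- by apply/connected_packing/(edge_connected_le _ Gc); lia.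
Qed.
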